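(* The number of distinct Golomb topologies associated to countably infinite domains is $\mathfrak{c}$, the cardinality of the continuum; that is, the number of homeomorphism classes of the spaces $G(R)$, as $R$ ranges over the countably infinite integral domains that are not fields, is $\mathfrak{c}$.
   Context: For an integral domain $R$ that is not a field, put $R^\bullet := R\setminus\{0\}$. The Golomb space $G(R)$ is the set $R^\bullet$ with the topology generated by the coprime cosets of $R$, i.e. by the sets $x+I$ (as subsets of $R^\bullet$, i.e. $(x+I)\cap R^\bullet$) where $x\in R^\bullet$, $I$ is a nonzero ideal of $R$, and $\langle x, I\rangle = R$. Two Golomb topologies are considered distinct when the spaces are not homeomorphic. Throughout the paper, integral domains are assumed not to be fields. *)

(* Defs.v *)
From HB Require Import structures.
From mathcomp Require Import all_boot all_algebra.
From mathcomp Require Import boolp classical_sets functions cardinality reals topology.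

Set Implicit Arguments.
Unset Strict Implicit.
Unset Printing Implicit Defensive.

Import GRing.Theory.
Local Open Scope classical_set_scope.
Local Open Scope card_scope.
Local Open Scope ring_scope.

(* [idealr_closed] from ring_quotient is not used: it requires 1 \notin I, while
   the unit ideal is allowed here. *)
Definition is_ideal (R : idomainType) (I : set R) : Prop :=
  I 0 /\ forall a u v : R, I u -> I v -> I (a * u + v).

Definition ideal_generated (R : idomainType) (A : set R) : set R :=
  smallest (@is_ideal R) A.

Definition golomb (R : idomainType) : Type := {x : R | x != 0}.

HB.instance Definition _ (R : idomainType) := Choice.on (golomb R).

Definition coprime_cosets (R : idomainType) : set (set (golomb R)) :=
  [set U | exists (x : R) (I : set R),
    [/\ x != 0, is_ideal I, I <> [set 0],
        ideal_generated ([set x] `|` I) = [set: R]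
      & U = [set y : golomb R | exists2 i, I i & val y = x + i]]].

HB.instance Definition _ (R : idomainType) :=
  isSubBaseTopological.Build (golomb R) (@coprime_cosets R) id.

Definition homeomorphic (X Y : topologicalType) : Prop :=
  exists (f : X -> Y) (g : Y -> X),
    [/\ cancel f g, cancel g f, continuous f & continuous g].

Definition countably_infinite (T : Type) : Prop := [set: T] #= [set: nat].

(* The homeomorphism class of X is the predicate [homeomorphic X].  Predicates on
   [topologicalType] live in a universe above the one of [set], hence the plain
   arrow and sigma type. *)
Definition golomb_homeo_class : Type :=
  {C : topologicalType -> Prop |
    exists R : idomainType,
      [/\ countably_infinite R, ~ GRing.field_axiom R
        & C = homeomorphic (golomb R)]}.

(* Main.v *)
Require Import Defs.
From HB Require Import structures.
From mathcomp Require Import all_boot all_order all_algebra.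
From mathcomp Require Import finmap ring lra zify.
From mathcomp Require Import boolp classical_sets functions cardinality reals topology.
From mathcomp.multinomials Require Import monalg.

(** Upper bound: numbering a countable domain by [nat] encodes it as a subset of
    [bool * nat * nat * nat] which determines it up to isomorphism.

    Lower bound: let [T] be the ring of integral polynomials in countably many
    variables, realized as the monoid algebra of the positive integers under
    multiplication, so that the prime numbers are the variables.  A point [p] of a
    countable set [N] kills the variables [q] such that [p] is not in [A q], where
    the sets [A q] are arbitrary except that the variable 2 is never killed.  This
    gives prime ideals [P_p], hence a support [supp f], the set of [p] such that
    [f] is not in [P_p].  Each [p] also defines a monomial order in which the
    monomials outside [P_p] come first.  After inverting the elements whose leading
    monomial is 1 for all these orders, distinct points [x] and [y] of the Golomb
    space have disjoint neighbourhoods iff their supports meet: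
    - if the supports are disjoint then [1 - x y r] is a unit for every [r], which
      makes any ideals [I] coprime to [x] and [J] coprime to [y] comaximal;
    - if they meet at [p] then [a = 1 - X_2 x y] is coprime to both [x] and [y],
      while comparing the degrees in [X_2] of leading monomials at [p] shows that a
      high power of [a] does not divide [x - y].
    When the supports contain all singletons, a homeomorphism thus carries the
    family of supports of one ring to that of the other along an injection of [N].
    Taking for the other [A q] the region [{(n, m) | m < n}] of [nat * nat] and
    the columns of index [k + 1] for [k] in [S], these sets are the minimal infinite
    supports, and [k] lies in [S] iff two distinct ones meet in [k + 1] points. *)

Set Implicit Arguments.
Unset Strict Implicit.
Unset Printing Implicit Defensive.

Import Order.TTheory GRing.Theory Num.Theory.
Local Open Scope classical_set_scope.
Local Open Scope card_scope.
Local Open Scope ring_scope.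

(** * The topology of a Golomb space *)

Section GolombTopology.
Variable R : idomainType.
Implicit Types (I J : set R) (U V : set (golomb R)).

Lemma ideal0 I : is_ideal I -> I 0.
Proof. by case. Qed.

Lemma idealD I a b : is_ideal I -> I a -> I b -> I (a + b).
Proof. by move=> [_ Il] Ia Ib; rewrite -[a]mul1r; apply: Il. Qed.

Lemma idealMl I r a : is_ideal I -> I a -> I (r * a).
Proof. by move=> [I0 Il] Ia; rewrite -[_ * _]addr0; apply: Il. Qed.

Lemma idealN I a : is_ideal I -> I a -> I (- a).
Proof. by move=> Iid Ia; rewrite -mulN1r; apply: idealMl. Qed.

Lemma is_idealI I J : is_ideal I -> is_ideal J -> is_ideal (I `&` J).
Proof.
move=> [I0 Il] [J0 Jl]; split=> // a u v [? ?] [? ?].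
by split; [apply: Il|apply: Jl].
Qed.

Lemma is_ideal_principal a : is_ideal [set a * r | r in [set: R]].
Proof.
split; first by exists 0; rewrite // mulr0.
by move=> c _ _ [u _ <-] [v _ <-]; exists (c * u + v); rewrite // mulrDr mulrCA.
Qed.

Lemma ideal_neq0 I : is_ideal I -> I <> [set 0] -> exists2 a, a != 0 & I a.
Proof.
move=> Iid In0; apply: contrapT => h; apply: In0; apply/seteqP; split=> [a Ia|_ ->].
  by apply/eqP; apply: contrapT => /negP a0; apply: h; exists a.
exact: ideal0.
Qed.

Lemma neq0_ideal I a : a != 0 -> I a -> I <> [set 0].
Proof. by move=> a0 Ia I0; move: Ia; rewrite I0 => /= /eqP; apply/negP. Qed.

Definition ideal_coprime (x : R) I := exists r, I (1 - x * r).

Lemma ideal_coprimeP x I : is_ideal I ->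
  ideal_coprime x I <-> ideal_generated ([set x] `|` I) = [set: R].
Proof.
move=> Iid; split=> [[r Ir]|gen].
  apply/seteqP; split=> // z _ J [Jid sJ].
  have J1 : J 1.
    rewrite -[1](subrK (x * r)); apply: idealD => //; first by apply: sJ; right.
    by rewrite mulrC; apply: idealMl => //; apply: sJ; left.
  by rewrite -[z]mulr1; apply: idealMl.
(* [J] is the ideal [x R + I]; that it contains 1 is the required congruence. *)
pose J := [set z | exists r, I (z - x * r)].
have Jid : is_ideal J.
  split; first by exists 0; rewrite mulr0 subr0; apply: ideal0.
  move=> a u v [r Iu] [s Iv]; exists (a * r + s).
  have -> : a * u + v - x * (a * r + s) = a * (u - x * r) + (v - x * s).
    by rewrite mulrDr mulrBr opprD addrACA mulrCA.
  by apply: Iid.2.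
have : [set: R] 1 by [].
rewrite -gen => /(_ J); apply; split=> // z [->|Iz].
  by exists 1; rewrite mulr1 subrr; apply: ideal0.
by exists 0; rewrite mulr0 subr0.
Qed.

Lemma ideal_coprimeI x I J : is_ideal I -> is_ideal J ->
  ideal_coprime x I -> ideal_coprime x J -> ideal_coprime x (I `&` J).
Proof.
move=> Iid Jid [r Ir] [s Js]; exists (r + s - x * r * s).
have -> : 1 - x * (r + s - x * r * s) = (1 - x * r) * (1 - x * s).
  by ring.
by split; [rewrite mulrC|]; apply: idealMl.
Qed.

Lemma ideal_coprime_trans x y I : is_ideal I -> I (y - x) ->
  ideal_coprime x I -> ideal_coprime y I.
Proof.
move=> Iid Iyx [r Ir]; exists r.
have -> : 1 - y * r = 1 - x * r - r * (y - x) by ring.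
by apply: idealD => //; apply: idealN => //; apply: idealMl.
Qed.

Definition coset_nbhd (x : golomb R) I := [set y : golomb R | I (val y - val x)].

Lemma open_coset_nbhd (x : golomb R) I : is_ideal I -> I <> [set 0] ->
  ideal_coprime (val x) I -> open (coset_nbhd x I).
Proof.
move=> Iid In0 Ix; exists [set coset_nbhd x I]; last by rewrite bigcup_set1.
move=> _ ->; apply: finI_from1; exists (val x), I; split=> //.
- exact: (valP x).
- exact/ideal_coprimeP.
apply/seteqP; split=> y /= => [Iyx|[i Ii ->]].
  by exists (val y - val x) => //; rewrite addrC subrK.
by rewrite /coset_nbhd /= addrC addKr.
Qed.

(** A subbasic coset [z + J] containing [x] equals [x + J], and [J] is then coprime to [x] as well.
    So finitely many of them around [x] contain a coset of the intersection of their ideals, which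
    is nonzero because it contains products of nonzero elements. *)
Lemma golomb_openP U : open U <-> forall x, U x ->
  exists I, [/\ is_ideal I, I <> [set 0], ideal_coprime (val x) I & coset_nbhd x I `<=` U].
Proof.
split=> [[D DC <-] x [A DA Ax]|Uop]; last first.
  rewrite openE => x /Uop[I [Iid In0 Ix IU]].
  rewrite /interior nbhsE; exists (coset_nbhd x I) => //; split.
    exact: open_coset_nbhd.
  by rewrite /coset_nbhd /= subrr; apply: ideal0.
suff [I [Iid In0 Ix IA]] : exists I, [/\ is_ideal I, I <> [set 0],
    ideal_coprime (val x) I & coset_nbhd x I `<=` A].
  by exists I; split=> // y /IA Ay; exists A.
have [E EC AE] := DC _ DA.
move: Ax; rewrite -{}AE bigcap_fset.
have : {in (E : seq _), forall B, coprime_cosets B} by move=> B /EC; rewrite inE.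
elim: {E EC} (E : seq _) => [|B s IHs] sC.
  exists setT; split; [by split| |by exists 0|by rewrite big_nil].
  by move=> T0; have : [set: R] 1 by []; rewrite T0 => /= /eqP; rewrite oner_eq0.
rewrite big_cons => Bsx; have [Bx sx] : B x /\ (\big[setI/setT]_(i <- s) i) x by exact: Bsx.
have [|I [Iid In0 Ix sI]] := IHs _ sx.
  by move=> C Cs; apply: sC; rewrite inE Cs orbT.
have [z [J [z0 Jid Jn0 /(ideal_coprimeP _ Jid) Jz BE]]] := sC B (mem_head _ _).
move: Bx; rewrite BE /= => -[j Jj xE].
have Jx : J (val x - z) by have -> : val x = z + j := xE; rewrite addrC addKr.
exists (I `&` J); split.
- exact: is_idealI.
- have [a a0 Ia] := ideal_neq0 Iid In0.
  have [b b0 Jb] := ideal_neq0 Jid Jn0.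
  apply: (@neq0_ideal _ (a * b)); first by rewrite mulf_neq0.
  by split; [rewrite mulrC|]; apply: idealMl.
- apply: ideal_coprimeI => //; exact: ideal_coprime_trans Jx Jz.
move=> y [Iyx Jyx]; split; last exact: sI.
exists (val y - z); last by rewrite addrC subrK.
by rewrite -(subrKA (val x)); apply: idealD.
Qed.

End GolombTopology.

(** * Separation by disjoint neighbourhoods *)

Definition nbhs_separated (X : topologicalType) (x y : X) :=
  exists U V : set X, [/\ open U, open V, U x, V y & U `&` V = set0].

Lemma nbhs_separated_homeo (X Y : topologicalType) (f : X -> Y) (g : Y -> X) :
  cancel f g -> cancel g f -> continuous f -> continuous g ->
  forall x y, nbhs_separated (f x) (f y) <-> nbhs_separated x y.
Proof.
move=> fK gK /continuousP fc /continuousP gc x y; split=> -[U [V [Uo Vo Ux Vy UV]]].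
  exists (f @^-1` U), (f @^-1` V); split=> //; [exact: fc|exact: fc|].
  by rewrite -preimage_setI UV preimage_set0.
exists (g @^-1` U), (g @^-1` V); split=> //; [exact: gc|exact: gc|..].
- by rewrite /preimage /= fK.
- by rewrite /preimage /= fK.
by rewrite -preimage_setI UV preimage_set0.
Qed.

Lemma golomb_not_separated (R : idomainType) (x y : golomb R) :
  (forall r, 1 - val x * val y * r \is a GRing.unit) -> ~ nbhs_separated x y.
Proof.
move=> xyU [U [V [/golomb_openP Uo /golomb_openP Vo /Uo + /Vo + UV]]].
move=> [I [Iid In0 [r Ir] IU]] [J [Jid Jn0 [s Js] JV]].
have [c [Ic Jc]] : exists c, I c /\ J (1 - c).
  have uU := xyU (r * s); set u := 1 - _ in uU.
  (* Dividing [u = y s (1 - x r) + (1 - y s)] by [u] splits 1 into an element of [I] and one of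
     [J]. *)
  exists (u^-1 * (val y * s) * (1 - val x * r)); split; first exact: idealMl.
  have -> : 1 - u^-1 * (val y * s) * (1 - val x * r) = u^-1 * (1 - val y * s).
    rewrite -[X in X - _](mulVr uU) -mulrA -mulrBr; congr (_ * _).
    by rewrite /u mulrACA; ring.
  exact: idealMl.
have [a a0 Ia] := ideal_neq0 Iid In0.
have [b b0 Jb] := ideal_neq0 Jid Jn0.
have : exists2 z, z != 0 & I (z - val x) /\ J (z - val y).
  have Iab : I (a * b) by rewrite mulrC; apply: idealMl.
  have Jab : J (a * b) by apply: idealMl.
  (* Chinese remainder: [z] is [x] modulo [I] and [y] modulo [J]. *)
  pose z := val x + c * (val y - val x).
  have Iz : I (z - val x) by rewrite addrC addKr mulrC; apply: idealMl.
  have Jz : J (z - val y).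
    have -> : z - val y = (val x - val y) * (1 - c).
      by rewrite /z; move: (val x) (val y) => p q; ring.
    exact: idealMl.
  (* The element 0 is not a point of the space. If [z] is 0, then [x] lies in [I] and [y] in [J], so
     the nonzero common element [a * b] serves instead. *)
  have [z0|] := eqVneq z 0; last by exists z.
  exists (a * b); first by rewrite mulf_neq0.
  by move: Iz Jz; rewrite z0 !sub0r; split; apply: idealD.
move=> [z z0 [Iz Jz]].
have : (U `&` V) (exist _ z z0) by split; [apply: IU|apply: JV].
by rewrite UV.
Qed.

Lemma golomb_separated (R : idomainType) (x y : golomb R) (I : set R) :
  is_ideal I -> I <> [set 0] -> ideal_coprime (val x) I ->
  ideal_coprime (val y) I -> ~ I (val x - val y) -> nbhs_separated x y.
Proof.
move=> Iid In0 Ix Iy Ixy.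
exists (coset_nbhd x I), (coset_nbhd y I); split.
- exact: open_coset_nbhd.
- exact: open_coset_nbhd.
- by rewrite /coset_nbhd /= subrr; apply: ideal0.
- by rewrite /coset_nbhd /= subrr; apply: ideal0.
apply/seteqP; split=> // z [Izx Izy]; apply: Ixy.
rewrite -(subrKA (val z)); apply: idealD => //.
by rewrite -opprB; apply: idealN.
Qed.

Lemma homeomorphic_refl (X : topologicalType) : homeomorphic X X.
Proof. by exists id, id; split=> // x; apply: cvg_id. Qed.

Lemma homeomorphic_sym (X Y : topologicalType) : homeomorphic X Y -> homeomorphic Y X.
Proof. by move=> [f [g [fK gK fc gc]]]; exists g, f. Qed.

Lemma homeomorphic_trans (X Y Z : topologicalType) :
  homeomorphic X Y -> homeomorphic Y Z -> homeomorphic X Z.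
Proof.
move=> [f [f' [fK f'K fc f'c]]] [g [g' [gK g'K gc g'c]]].
exists (g \o f), (f' \o g'); split.
- by move=> x /=; rewrite gK fK.
- by move=> x /=; rewrite f'K g'K.
- by move=> x; apply: continuous_comp; [exact: fc|exact: gc].
- by move=> x; apply: continuous_comp; [exact: g'c|exact: f'c].
Qed.

(** * Isomorphic domains have homeomorphic Golomb spaces *)

Section GolombIso.
Variables (R R' : idomainType) (f : R -> R') (g : R' -> R).
Hypotheses (fK : cancel f g) (gK : cancel g f).
Hypotheses (fD : {morph f : a b / a + b}) (fM : {morph f : a b / a * b}).

Lemma iso0 : f 0 = 0.
Proof. by apply: (addrI (f 0)); rewrite -fD !addr0. Qed.

Lemma isoN a : f (- a) = - f a.
Proof. by apply: (addrI (f a)); rewrite -fD !subrr iso0. Qed.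

Lemma iso1 : f 1 = 1.
Proof. by rewrite -[LHS]mulr1 -[in LHS](gK 1) -fM mul1r. Qed.

Lemma iso_eq0 a : (f a == 0) = (a == 0).
Proof. by rewrite -iso0 (can_eq fK). Qed.

Definition golomb_map (x : golomb R) : golomb R' :=
  exist _ (f (val x)) (eq_ind_r is_true (valP x) (congr1 negb (iso_eq0 (val x)))).

Lemma golomb_map_continuous : continuous golomb_map.
Proof.
apply/continuousP => U /golomb_openP Uo; apply/golomb_openP => x /Uo.
move=> [I [Iid In0 [r Ir] IU]]; exists (f @^-1` I); split.
- split; rewrite /preimage /= ?iso0; first exact: ideal0.
  by move=> a u v Iu Iv; rewrite fD fM; apply: Iid.2.
- have [a a0 Ia] := ideal_neq0 Iid In0.
  by apply: (@neq0_ideal _ _ (g a)); rewrite -?iso_eq0 /preimage /= gK.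
- by exists (g r); rewrite /preimage /= fD isoN fM gK iso1.
by move=> y Iy; apply: IU; move: Iy; rewrite /coset_nbhd /preimage /= fD isoN.
Qed.

End GolombIso.

Lemma golomb_iso (R R' : idomainType) (f : R -> R') (g : R' -> R) :
  cancel f g -> cancel g f -> {morph f : a b / a + b} -> {morph f : a b / a * b} ->
  homeomorphic (golomb R) (golomb R').
Proof.
move=> fK gK fD fM.
have gD : {morph g : a b / a + b} by move=> a b; apply: (can_inj fK); rewrite fD !gK.
have gM : {morph g : a b / a * b} by move=> a b; apply: (can_inj fK); rewrite fM !gK.
exists (golomb_map fK fD), (golomb_map gK gD); split.
- by move=> x; apply: val_inj; apply: fK.
- by move=> x; apply: val_inj; apply: gK.
- exact: golomb_map_continuous.
- exact: golomb_map_continuous.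
Qed.

(** * Counting homeomorphism classes *)

Section RealSubsets.
Variable R : realType.

(** Base 3 with digits 0 and 1: unlike in base 2, two expansions never have the same value. *)
Definition ternary_sum (S : set nat) (n : nat) : R :=
  \sum_(i < n | `[< S i >]) 3%:R ^- i.

Definition ternary (S : set nat) : R := sup (range (ternary_sum S)).

Lemma ternary_sumS S n :
  ternary_sum S n.+1 = ternary_sum S n + (`[< S n >])%:R * 3%:R ^- n.
Proof.
rewrite /ternary_sum big_mkcond big_ord_recr /= -big_mkcond /=.
by case: `[< S n >]; rewrite ?mul1r ?mul0r.
Qed.

Lemma ternary_sum_le S n m : (n <= m)%N -> ternary_sum S n <= ternary_sum S m.
Proof.
move=> /subnK <-; elim: (m - n)%N => // k IHk; apply: le_trans IHk _.
by rewrite addSn ternary_sumS lerDl mulr_ge0 // ?ler0n // invr_ge0 exprn_ge0.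
Qed.

(* The constant is the sum of the [3 ^- i] for [i >= n]. *)
Lemma ternary_sum_ge S n m : (n <= m)%N ->
  ternary_sum S m <= ternary_sum S n + 3%:R / 2%:R * 3%:R ^- n.
Proof.
move=> nm; suff : ternary_sum S m + 3%:R / 2%:R * 3%:R ^- m <=
    ternary_sum S n + 3%:R / 2%:R * 3%:R ^- n.
  by apply: le_trans; rewrite lerDl mulr_ge0 ?divr_ge0 ?invr_ge0 ?exprn_ge0.
move: nm => /subnK <-; elim: (m - n)%N => // k IHk; apply: le_trans IHk.
rewrite addSn ternary_sumS -addrA lerD2l exprS invfM.
have : 0 <= (3%:R : R) ^- (k + n) by rewrite invr_ge0 exprn_ge0.
by move: (_ ^- _) => u u0; case: `[< _ >]; rewrite ?mul1r ?mul0r; lra.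
Qed.

Lemma ternary_has_sup S : has_sup (range (ternary_sum S)).
Proof.
split; first by exists (ternary_sum S 0), 0%N.
exists (ternary_sum S 0 + 3%:R / 2%:R * 3%:R ^- 0) => _ [n _ <-].
exact: ternary_sum_ge.
Qed.

(** At the first index [n] where the sets differ, the digit 1 is worth [3 ^- n], while all later
    digits together are worth at most half of that. *)
Lemma ternary_inj : injective ternary.
Proof.
have main S S' n : (forall i, (i < n)%N -> S i <-> S' i) -> S n -> ~ S' n ->
    ternary S' < ternary S.
  move=> SS' Sn S'n.
  have En : ternary_sum S' n = ternary_sum S n.
    by apply: eq_bigl => i; apply: asbool_equiv_eq; apply: iff_sym; apply: SS'.
  apply: (@lt_le_trans _ _ (ternary_sum S n + 3%:R ^- n)); last first.
    have := sup_upper_bound (ternary_has_sup S).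
    move=> /(_ (ternary_sum S n.+1)); rewrite ternary_sumS asboolT // mul1r.
    by apply; exists n.+1; rewrite // ternary_sumS asboolT // mul1r.
  apply: (@le_lt_trans _ _ (ternary_sum S n + 2%:R^-1 * 3%:R ^- n)); last first.
    have : 0 < (3%:R : R) ^- n by rewrite invr_gt0 exprn_gt0.
    by rewrite ltrD2l; move: (_ ^- _) => u u0; lra.
  apply: ge_sup; first by case: (ternary_has_sup S').
  move=> _ [m _ <-].
  apply: (@le_trans _ _ (ternary_sum S' (maxn m n.+1))).
    by apply: ternary_sum_le; apply: leq_maxl.
  apply: le_trans (ternary_sum_ge _ (leq_maxr m n.+1)) _.
  rewrite ternary_sumS asboolF // mul0r addr0 En lerD2l exprS invfM.
  by move: (_ ^- _) => u; lra.
move=> S S' e; apply: contrapT => SS'.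
have : exists n, ~~ `[< S n <-> S' n >].
  apply: contrapT => h; apply: SS'; apply/seteqP; split=> n Sn;
    apply: contrapT => S'n; apply: h; exists n; apply/asboolPn; tauto.
move=> exn; case: (ex_minnP exn) => n /asboolPn nn minn.
have lt i : (i < n)%N -> S i <-> S' i.
  by move=> ltin; apply: contrapT => /asboolPn /minn; rewrite leqNgt ltin.
have [Sn|Sn] := pselect (S n).
  have S'n : ~ S' n by tauto.
  by have := main _ _ _ lt Sn S'n; rewrite e ltxx.
have S'n : S' n by apply: contrapT; tauto.
have lt' i : (i < n)%N -> S' i <-> S i by move=> /lt; tauto.
by have := main _ _ _ lt' S'n Sn; rewrite e ltxx.
Qed.

Definition pickle_set (K : countType) (A : set K) : set nat := choice.pickle @` A.

Lemma pickle_set_inj (K : countType) : injective (@pickle_set K).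
Proof.
have main (A B : set K) : pickle_set A = pickle_set B -> A `<=` B.
  move=> e a Aa; have : pickle_set B (choice.pickle a) by rewrite -e; exists a.
  by move=> [b Bb /(pcan_inj (@choice.pickleK K)) <-].
by move=> A B e; apply/seteqP; split; apply: main.
Qed.

Lemma rat_cut_inj : injective (fun x : R => [set q : rat | ratr q < x]).
Proof.
have main (x y : R) : x < y ->
    [set q : rat | ratr q < x] <> [set q : rat | ratr q < y].
  move=> /rat_in_itvoo[q]; rewrite inE => /andP[] /= xq qy e.
  have : [set q : rat | ratr q < y] q by [].
  by rewrite -e /= => /(lt_trans xq); rewrite ltxx.
by move=> x y e; have [xy|xy|//] := ltgtP x y; [have := main _ _ xy|have := main _ _ xy];
  rewrite e.
Qed.

Lemma injective_card_le (T U : Type) (A : set T) (B : set U) (f : T -> U) :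
  (forall x, A x -> B (f x)) -> {in A &, injective f} -> A #<= B.
Proof.
move=> AB /inj_card_eq; rewrite card_eq_sym card_eq_le => /andP[fA _].
apply: card_le_trans fA _; apply: subset_card_le => _ [x Ax <-]; exact: AB.
Qed.

Lemma card_real_set_nat : [set: R] #= [set: set nat].
Proof.
apply: Cantor_Bernstein.
  apply: (@injective_card_le _ _ _ _ (fun x => pickle_set [set q : rat | ratr q < x])) => //.
  by move=> x y _ _ /pickle_set_inj/rat_cut_inj.
by apply: (@injective_card_le _ _ _ _ ternary) => // S S' _ _ /ternary_inj.
Qed.

End RealSubsets.

(** * Codes of countable domains *)

Definition ring_code (R : idomainType) (e : R -> nat) : set (bool * nat * nat * nat) :=
  [set t | exists a b, t = (false, e a, e b, e (a + b)) \/ t = (true, e a, e b, e (a * b))].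

(** The code consists of the graphs of addition and multiplication, so matching elements that have
    the same number is a ring isomorphism. *)
Lemma ring_code_homeo (R R' : idomainType) (e : R -> nat) (e' : R' -> nat) :
  bijective e -> bijective e' -> ring_code e = ring_code e' ->
  homeomorphic (golomb R) (golomb R').
Proof.
move=> [d eK dK] [d' e'K d'K] ee'.
have sub b x y z : ring_code e (b, e x, e y, e z) ->
    e' (if b then d' (e x) * d' (e y) else d' (e x) + d' (e y)) = e z.
  by rewrite ee' => -[u [v [[-> -> -> ->]|[-> -> -> ->]]]]; rewrite !e'K.
apply: (@golomb_iso _ _ (d' \o e) (d \o e')).
- by move=> x /=; rewrite d'K eK.
- by move=> x /=; rewrite dK e'K.
- move=> a b /=; have /sub <- : ring_code e (false, e a, e b, e (a + b)).
    by exists a, b; left.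
  by rewrite e'K.
move=> a b /=; have /sub <- : ring_code e (true, e a, e b, e (a * b)).
  by exists a, b; right.
by rewrite e'K.
Qed.

Definition realizes (c : set (bool * nat * nat * nat)) (R : idomainType) : Prop :=
  [/\ countably_infinite R, ~ GRing.field_axiom R &
    exists2 e : R -> nat, bijective e & c = ring_code e].

(** For a realized code this is a single homeomorphism class, whichever domain realizes it. *)
Definition code_class (c : set (bool * nat * nat * nat)) (X : topologicalType) : Prop :=
  exists2 R, realizes c R & homeomorphic (golomb R) X.

Lemma code_classE c R : realizes c R -> code_class c = homeomorphic (golomb R).
Proof.
move=> cR; apply/funext => X; apply/propext; split=> [[R' cR' R'X]|RX]; last first.
  by exists R.
case: cR cR' => _ _ [e eb ->] [_ _ [e' e'b ee']].
exact: homeomorphic_trans (ring_code_homeo eb e'b ee') R'X.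
Qed.

Lemma exists_realizes (R : idomainType) :
  countably_infinite R -> ~ GRing.field_axiom R -> exists c, realizes c R.
Proof.
move=> Rc Rf; have /card_set_bijP[e] := Rc; rewrite setTT_bijective => eb.
by exists (ring_code e); split=> //; exists e.
Qed.

(** * The bijection between real numbers and homeomorphism classes *)

Section Counting.
Variable R : realType.
Variable ring_of : set nat -> idomainType.
Hypothesis ring_of_countable : forall S, countably_infinite (ring_of S).
Hypothesis ring_of_not_field : forall S, ~ GRing.field_axiom (ring_of S).
Hypothesis ring_of_inj : forall S S',
  homeomorphic (golomb (ring_of S)) (golomb (ring_of S')) -> S = S'.

(** Homeomorphism classes live in too large a universe to be elements of a [set]; each one is
    represented by the nonempty block of all its codes. *)
Let class_codes (C : topologicalType -> Prop) :=
  [set c | (exists R, realizes c R) /\ code_class c = C].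

Let code_blocks : set (set (set (bool * nat * nat * nat))) :=
  [set A | exists c R, realizes c R /\ A = class_codes (code_class c)].

Let class_codes_get A : code_blocks A ->
  (exists R, realizes (get A) R) /\ A = class_codes (code_class (get A)).
Proof.
move=> [c [K [cK AE]]].
have /getPex : exists c, A c by exists c; rewrite AE; split=> //; exists K.
move=> Ag; have : class_codes (code_class c) (get A) by rewrite -AE.
by move=> [? cE]; split=> //; rewrite cE.
Qed.

(** A block is determined by the code that [get] selects in it, which gives the upper bound; the
    family [ring_of] provides one block for each set of naturals. *)
Lemma card_code_blocks : [set: R] #= code_blocks.
Proof.
apply: card_eq_trans (card_real_set_nat R) _; apply: Cantor_Bernstein; last first.
  apply: (@injective_card_le _ _ _ _ (fun A => pickle_set (get A))) => //.
  move=> A B /set_mem/class_codes_get[_ AE] /set_mem/class_codes_get[_ BE].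
  by move=> /pickle_set_inj AB; rewrite AE BE AB.
pose G S := homeomorphic (golomb (ring_of S)).
apply: (@injective_card_le _ _ _ _ (fun S => class_codes (G S))).
  move=> S _; have [c cS] := exists_realizes (@ring_of_countable S) (@ring_of_not_field S).
  by exists c, (ring_of S); rewrite (code_classE cS).
move=> S S' _ _ SS'; apply/esym/ring_of_inj.
have [c cS] := exists_realizes (@ring_of_countable S) (@ring_of_not_field S).
have : class_codes (G S) c by split; [exists (ring_of S)|exact: code_classE].
rewrite SS' => -[_]; rewrite (code_classE cS) -/(G S') => SS'E.
by change (G S' (golomb (ring_of S))); rewrite -SS'E; apply: homeomorphic_refl.
Qed.

(** A class and its block determine each other: [class_codes] goes one way, and [code_class] of the
    code selected by [get] goes back. *)
Lemma bijection_golomb_homeo_class : exists f : R -> golomb_homeo_class, bijective f.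
Proof.
have /card_set_bijP[f [fA finj fsurj]] := card_code_blocks.
have classP r : exists K : idomainType, [/\ countably_infinite K,
    ~ GRing.field_axiom K & code_class (get (f r)) = homeomorphic (golomb K)].
  have [[K rK] _] := class_codes_get (fA r I).
  by exists K; split; [case: rK|case: rK|exact: code_classE].
have onto (C : golomb_homeo_class) : exists r, f r = class_codes (sval C).
  case: C => C [K [Kc Kf CE]] /=.
  have [c cK] := exists_realizes Kc Kf.
  have /fsurj[r _ rE] : code_blocks (class_codes C).
    by exists c, K; rewrite (code_classE cK) CE.
  by exists r.
have class_inj (C D : golomb_homeo_class) : sval C = sval D -> C = D.
  by case: C D => [C p] [D q] /= CD; subst D; rewrite (Prop_irrelevance p q).
pose F r : golomb_homeo_class := exist _ (code_class (get (f r))) (classP r).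
exists F, (fun C => sval (cid (onto C))).
  move=> r; case: cid => /= r'; have [_ <-] := class_codes_get (fA r I).
  by apply: finj; rewrite inE.
move=> C; apply: class_inj; case: cid => /= r rE.
have [[K rK] e] := class_codes_get (fA r I).
have : class_codes (code_class (get (f r))) (get (f r)) by split=> //; exists K.
by rewrite -e {1}rE => -[].
Qed.
End Counting.

(** * Localization at a multiplicative set *)

(* Units and inverses are obtained by classical choice. *)
HB.factory Record ComNzRing_isDomain R of GRing.ComNzRing R := {
  domain_mulf_eq0 : GRing.integral_domain_axiom R
}.

HB.builders Context R of ComNzRing_isDomain R.

Let isunit : {pred R} := fun x => `[< exists y, y * x = 1 >].

Let inverse (x : R) : R :=
  if pselect (exists y, y * x = 1) is left e then sval (cid e) else x.

Fact inverse_mul : {in isunit, left_inverse 1 inverse *%R}.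
Proof. by move=> x /asboolP xU; rewrite /inverse; case: pselect => // e; case: cid. Qed.

Fact isunitP (x y : R) : y * x = 1 -> isunit x.
Proof. by move=> yx; apply/asboolP; exists y. Qed.

Fact inverse_out : {in [predC isunit], inverse =1 id}.
Proof.
move=> x /negP xU; rewrite /inverse; case: pselect => // -[y yx].
by case: xU; apply: isunitP yx.
Qed.

HB.instance Definition _ :=
  GRing.ComNzRing_hasMulInverse.Build R inverse_mul isunitP inverse_out.
HB.instance Definition _ := GRing.ComUnitRing_isIntegral.Build R domain_mulf_eq0.

HB.end.

Structure mult_set (T : idomainType) := MultSet {
  mset :> T -> Prop;
  mset1 : mset 1;
  msetM : forall s t, mset s -> mset t -> mset (s * t);
  mset_neq0 : forall s, mset s -> s != 0 }.

Section Localization.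
Variables (T : idomainType) (W : mult_set T).
Local Notation "x %:F" := (@FracField.tofrac T x).

Definition in_localization : {pred {fraction T}} :=
  fun x => `[< exists f s, W s /\ x = f%:F / s%:F >].

Lemma in_localization_subring : subring_closed in_localization.
Proof.
split=> [|x y /asboolP[f [s [Ws ->]]] /asboolP[g [t [Wt ->]]]|
          x y /asboolP[f [s [Ws ->]]] /asboolP[g [t [Wt ->]]]]; apply/asboolP.
- by exists 1, 1; split; [exact: mset1|rewrite tofrac1 divr1].
- exists (f * t - g * s), (s * t); split; first exact: msetM.
  by rewrite tofracB !tofracM -mulNr addf_div ?tofrac_eq0 ?(mset_neq0 Ws) ?(mset_neq0 Wt) ?mulNr.
by exists (f * g), (s * t); split; [exact: msetM|rewrite !tofracM mulf_div].
Qed.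

HB.instance Definition _ :=
  GRing.isSubringClosed.Build {fraction T} in_localization in_localization_subring.

Definition localization := {x : {fraction T} | x \in in_localization}.

HB.instance Definition _ := SubChoice.on localization.
HB.instance Definition _ := [SubChoice_isSubComNzRing of localization by <:].

Fact localization_integral : GRing.integral_domain_axiom localization.
Proof.
move=> x y xy; have /eqP : val (x * y) = 0 by rewrite xy.
by rewrite /= mulf_eq0 -!(inj_eq val_inj).
Qed.

HB.instance Definition _ := ComNzRing_isDomain.Build localization localization_integral.

Fact frac_in_localization f s : W s -> f%:F / s%:F \in in_localization.
Proof. by move=> Ws; apply/asboolP; exists f, s. Qed.

Definition loc_frac f s (Ws : W s) : localization :=
  exist _ (f%:F / s%:F) (frac_in_localization f Ws).

Lemma localizationP (x : localization) : exists f s (Ws : W s), x = loc_frac f Ws.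
Proof.
have /asboolP[f [s [Ws xE]]] := valP x.
by exists f, s, Ws; apply: val_inj.
Qed.

Lemma loc_frac_eq f s (Ws : W s) g t (Wt : W t) :
  (loc_frac f Ws == loc_frac g Wt) = (f * t == g * s).
Proof.
rewrite -(inj_eq val_inj) /= eqr_div ?tofrac_eq0 ?(mset_neq0 Ws) ?(mset_neq0 Wt) //.
by rewrite -!tofracM tofrac_eq.
Qed.

Lemma loc_frac0 f s (Ws : W s) : (loc_frac f Ws == 0) = (f == 0).
Proof.
rewrite -(inj_eq val_inj) /= mulf_eq0 invr_eq0 !tofrac_eq0.
by rewrite (negPf (mset_neq0 Ws)) orbF.
Qed.

Lemma loc_frac1 : loc_frac 1 (mset1 W) = 1.
Proof. by apply: val_inj; rewrite /= tofrac1 divr1. Qed.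

Lemma loc_fracM f s (Ws : W s) g t (Wt : W t) :
  loc_frac f Ws * loc_frac g Wt = loc_frac (f * g) (msetM Ws Wt).
Proof. by apply: val_inj; rewrite /= mulf_div !tofracM. Qed.

Lemma loc_fracB f s (Ws : W s) g t (Wt : W t) :
  loc_frac f Ws - loc_frac g Wt = loc_frac (f * t - g * s) (msetM Ws Wt).
Proof.
apply: val_inj.
rewrite /= -mulNr addf_div ?tofrac_eq0 ?(mset_neq0 Ws) ?(mset_neq0 Wt) //.
by rewrite mulNr tofracB !tofracM.
Qed.

Lemma loc_frac_1subX f k :
  (1 - loc_frac f (mset1 W)) ^+ k = loc_frac ((1 - f) ^+ k) (mset1 W).
Proof.
elim: k => [|k IHk]; first by rewrite expr0 -loc_frac1; apply/eqP; rewrite loc_frac_eq expr0.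
rewrite !exprS IHk -[X in X - _]loc_frac1 loc_fracB loc_fracM; apply/eqP.
by rewrite loc_frac_eq !mulr1.
Qed.

Lemma loc_fracM_clear c f g s (Ws : W s) :
  loc_frac f Ws * loc_frac (c * g * s) (mset1 W) = loc_frac (c * (f * g)) (mset1 W).
Proof. by rewrite loc_fracM; apply/eqP; rewrite loc_frac_eq; apply/eqP; ring. Qed.

Lemma loc_fracB_dvd a h u (Wu : W u) f s (Ws : W s) g t (Wt : W t) :
  loc_frac a (mset1 W) * loc_frac h Wu = loc_frac f Ws - loc_frac g Wt ->
  a * h * (s * t) = (f * t - g * s) * u.
Proof.
by rewrite loc_fracM loc_fracB => /eqP; rewrite loc_frac_eq mul1r => /eqP.
Qed.

Lemma loc_frac_1subM f s (Ws : W s) g t (Wt : W t) h u (Wu : W u) :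
  1 - loc_frac f Ws * loc_frac g Wt * loc_frac h Wu =
  loc_frac (s * t * u - f * g * h) (msetM (msetM Ws Wt) Wu).
Proof.
rewrite -loc_frac1 !loc_fracM loc_fracB; apply/eqP.
by rewrite loc_frac_eq !mul1r !mulr1.
Qed.

Lemma loc_frac_unit f s (Ws : W s) : W f -> loc_frac f Ws \is a GRing.unit.
Proof.
move=> Wf; apply/unitrPr; exists (loc_frac s Wf); rewrite loc_fracM -loc_frac1.
by apply/eqP; rewrite loc_frac_eq mulr1 mul1r mulrC.
Qed.

Lemma localization_countable : countable [set: T] -> countable [set: localization].
Proof.
(* The value 0 is a default for pairs whose second component is not a denominator. *)
move=> Tc; pose F (p : T * T) : localization :=
  if pselect (W p.2) is left Wp then loc_frac p.1 Wp else 0.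
have : countable (F @` ([set: T] `*` [set: T])).
  by apply: (sub_countable (card_image_le _ _)); apply: countableX.
apply: sub_countable; apply: subset_card_le => x _.
have [f [s [Ws ->]]] := localizationP x; exists (f, s) => //.
by rewrite /F /=; case: pselect => // Ws'; apply/eqP; rewrite loc_frac_eq.
Qed.

End Localization.

(** * Leading monomials in monoid algebras *)

Section LeadingMonomial.
Variables (M : conomType) (A : idomainType) (lt : rel M).
Hypothesis lt_irr : irreflexive lt.
Hypothesis lt_trans : transitive lt.
Hypothesis lt_total : forall m n, m != n -> lt m n || lt n m.
Hypothesis lt_mul : forall m n k, lt m n -> lt (mmul m k) (mmul n k).
Implicit Types (f g : {malg A[M]}) (m n k : M).

(** Leading means smallest for [lt]. A minimum exists because polynomials have finitely many
    monomials, even if [lt] is not well founded. *)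
Definition is_lead f m :=
  f@_m != 0 /\ forall n, f@_n != 0 -> n != m -> lt m n.

Lemma exists_lead f : f != 0 -> exists m, is_lead f m.
Proof.
rewrite -msupp_eq0 => f0.
suff [m [mf mlt]] : exists m, m \in (msupp f : seq M) /\
    forall n, n \in (msupp f : seq M) -> n != m -> lt m n.
  by exists m; split; [|move=> n]; rewrite mcoeff_neq0 // => /mlt.
have : (msupp f : seq M) != [::].
  apply: contraNN f0 => /eqP f0; apply/eqP/fsetP => m.
  by rewrite inE -[RHS](in_nil m) -f0.
elim: (msupp f : seq M) => // m s IHs _.
have [{IHs} ->|/IHs[n [ns nlt]]] := eqVneq s [::].
  by exists m; rewrite inE eqxx; split=> // n; rewrite inE => /eqP ->; rewrite eqxx.
have [mn|nm] := eqVneq m n.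
  exists n; rewrite inE ns orbT; split=> // k; rewrite inE => /predU1P[->|ks].
    by rewrite mn eqxx.
  exact: nlt.
have /orP[ltmn|ltnm] := lt_total nm.
  exists m; rewrite inE eqxx; split=> // k; rewrite inE => /predU1P[->|ks km].
    by rewrite eqxx.
  have [->//|kn] := eqVneq k n.
  exact: lt_trans ltmn (nlt _ ks kn).
exists n; rewrite inE ns orbT; split=> // k; rewrite inE => /predU1P[-> //|ks].
exact: nlt.
Qed.

Lemma is_lead_unique f m n : is_lead f m -> is_lead f n -> m = n.
Proof.
move=> [fm lm] [fn ln]; apply/eqP; apply: contraT => mn.
have := lt_trans (ln _ fm mn) (lm _ fn _).
by rewrite eq_sym mn lt_irr => /(_ isT).
Qed.

(** Every other pair of monomials has a product larger than [mmul m n], so this monomial arises only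
    once and its coefficient is a product of two nonzero elements of a domain. *)
Lemma is_lead_mul f g m n : is_lead f m -> is_lead g n -> is_lead (f * g) (mmul m n).
Proof.
move=> [fm lm] [gn ln].
have lt2 k l : f@_k != 0 -> g@_l != 0 -> (k != m) || (l != n) ->
    lt (mmul m n) (mmul k l).
  move=> fk gl; have [->|km] := eqVneq k m; have [->|ln'] := eqVneq l n => //= _.
  - by rewrite ![mmul m _]mulmC; apply/lt_mul/ln.
  - exact/lt_mul/lm.
  apply: (@lt_trans (mmul k n)); first exact/lt_mul/lm.
  by rewrite ![mmul k _]mulmC; apply/lt_mul/ln.
split; last first.
  move=> k; rewrite mcoeff_neq0 => /msuppM_le[k1 [k2 []]].
  rewrite -!mcoeff_neq0 => fk1 gk2 ->; have [->|k1m] := eqVneq k1 m.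
    by have [->|k2n] := eqVneq k2 n; rewrite ?eqxx // => _; apply: lt2; rewrite ?k2n ?orbT.
  by move=> _; apply: lt2; rewrite ?k1m.
have mf : m \in msupp f by rewrite -mcoeff_neq0.
have ng : n \in msupp g by rewrite -mcoeff_neq0.
rewrite mcoeffMl (bigD1_seq m) ?fset_uniq //= (bigD1_seq n) ?fset_uniq //= eqxx mulr1n.
rewrite [X in _ + X + _]big_seq_cond big1 ?addr0.
  rewrite [X in _ + X]big_seq_cond big1 ?addr0 ?mulf_neq0 //.
  move=> k /andP[]; rewrite -mcoeff_neq0 => fk km.
  rewrite big_seq big1 // => l; rewrite -mcoeff_neq0 => gl.
  have := lt2 _ _ fk gl; rewrite km => /(_ isT).
  by case: eqP => // ->; rewrite lt_irr.
move=> l /andP[]; rewrite -mcoeff_neq0 => gl ln'.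
have := lt2 _ _ fm gl; rewrite ln' orbT => /(_ isT).
by case: eqP => // ->; rewrite lt_irr.
Qed.

Lemma is_leadN f m : is_lead f m -> is_lead (- f) m.
Proof.
by move=> [fm lm]; split=> [|n]; rewrite mcoeffN oppr_eq0 => // /lm.
Qed.

Lemma is_leadD f g m : is_lead f m -> (forall n, g@_n != 0 -> lt m n) ->
  is_lead (f + g) m.
Proof.
move=> [fm lm] ltg; split.
  rewrite mcoeffD; have [->|/ltg] := eqVneq g@_m 0; first by rewrite addr0.
  by rewrite lt_irr.
move=> n; rewrite mcoeffD; have [->|/ltg //] := eqVneq g@_n 0.
by rewrite addr0 => fn; apply: lm.
Qed.

Lemma is_lead_neq0 f m : is_lead f m -> f != 0.
Proof. by move=> [fm _]; apply: contraNneq fm => ->; rewrite mcoeff0. Qed.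

Lemma malg_mulf_eq0 : GRing.integral_domain_axiom {malg A[M]}.
Proof.
move=> f g fg0; apply/norP => -[/exists_lead[m fm] /exists_lead[n gn]].
by have /is_lead_neq0 := is_lead_mul fm gn; rewrite fg0 eqxx.
Qed.

End LeadingMonomial.

(** * Dirichlet polynomials *)

Definition posn := {n : nat | (0 < n)%N}.

HB.instance Definition _ := [Countable of posn by <:].

Section PosnMonoid.
Implicit Types m n k : posn.

Definition posn_one : posn := exist _ 1%N isT.

Fact posn_mul_subproof m n : (0 < val m * val n)%N.
Proof. by rewrite muln_gt0 (valP m) (valP n). Qed.

Definition posn_mul m n : posn := exist _ (val m * val n)%N (posn_mul_subproof m n).

Fact posn_mulA : associative posn_mul.
Proof. by move=> m n k; apply: val_inj; rewrite /= mulnA. Qed.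

Fact posn_mul1 : left_id posn_one posn_mul.
Proof. by move=> m; apply: val_inj; rewrite /= mul1n. Qed.

Fact posn_mulC : commutative posn_mul.
Proof. by move=> m n; apply: val_inj; rewrite /= mulnC. Qed.

Fact posn_mulr1 : right_id posn_one posn_mul.
Proof. by move=> m; rewrite posn_mulC posn_mul1. Qed.

Fact posn_unit m n : posn_mul m n = posn_one -> m = posn_one /\ n = posn_one.
Proof.
move=> /(congr1 val) /= /eqP; rewrite muln_eq1 => /andP[/eqP m1 /eqP n1].
by split; apply: val_inj.
Qed.

HB.instance Definition _ := Choice_isMonomialDef.Build posn
  posn_mulA posn_mul1 posn_mulr1 posn_unit.
HB.instance Definition _ := MonomialDef_isConomialDef.Build posn posn_mulC.

(* [pi] is the set of variables killed at a point: the monomials free of them come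
   first, and among these the ones of higher degree in the variable 2. *)
Definition posn_lt (pi : nat_pred) m n :=
  let: (m, n) := (val m, val n) in
  (m`_pi < n`_pi)%N || (m`_pi == n`_pi)%N &&
    ((logn 2 n < logn 2 m)%N || (logn 2 n == logn 2 m) && (m < n)%N).

Variable pi : nat_pred.

Lemma posn_lt_irr : irreflexive (posn_lt pi).
Proof. by move=> m; rewrite /posn_lt !ltnn !eqxx. Qed.

Lemma posn_lt_trans : transitive (posn_lt pi).
Proof.
move=> n m k; rewrite /posn_lt.
move: (partn (val m) pi) (partn (val n) pi) (partn (val k) pi) => a b c.
move: (logn 2 (val m)) (logn 2 (val n)) (logn 2 (val k)) => a' b' c'.
by move: (val m) (val n) (val k) => a'' b'' c''; lia.
Qed.

Lemma posn_lt_total m n : m != n -> posn_lt pi m n || posn_lt pi n m.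
Proof.
rewrite /posn_lt -(inj_eq val_inj); move: (partn (val m) pi) (partn (val n) pi) => a b.
move: (logn 2 (val m)) (logn 2 (val n)) => a' b'.
by move: (val m) (val n) => a'' b''; lia.
Qed.

Lemma posn_lt_mul m n k : posn_lt pi m n -> posn_lt pi (mmul m k) (mmul n k).
Proof.
have [m0 n0 k0] : [/\ 0 < val m, 0 < val n & 0 < val k]%N.
  by split; apply: valP.
rewrite /posn_lt /= !partnM // !lognM //.
by rewrite !ltn_pmul2r ?part_gt0 // !eqn_pmul2r ?part_gt0 // ltn_add2r eqn_add2r.
Qed.

End PosnMonoid.

Definition dirichlet := {malg int[posn]}.

HB.instance Definition _ := GRing.ComNzRing.on dirichlet.
(** One monomial order is enough for integrality; [pred0] gives the one where no variable is
    killed. *)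
HB.instance Definition _ := ComNzRing_isDomain.Build dirichlet
  (malg_mulf_eq0 (posn_lt_irr pred0) (@posn_lt_trans pred0) (@posn_lt_total pred0)
     (@posn_lt_mul pred0)).

Lemma dirichlet_countable : countable [set: dirichlet].
Proof.
pose F (f : dirichlet) := [seq (m, f@_m) | m <- (msupp f : seq posn)].
apply: (sub_countable _ (countableP [set: seq (posn * int)])).
rewrite -(card_le_eql (inj_card_eq (f := F) _)).
  exact: card_leT.
move=> f g _ _ fg; apply/malgP => m.
have sub (u v : dirichlet) : F u = F v -> u@_m != 0 -> u@_m = v@_m.
  move=> uv; rewrite mcoeff_neq0 => mu.
  have : (m, u@_m) \in F v by rewrite -uv; apply: map_f.
  by move=> /mapP[k kv [-> ->]].
have [f0|f0] := eqVneq f@_m 0; last exact: sub.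
have [g0|g0] := eqVneq g@_m 0; first by rewrite f0 g0.
exact/esym/sub.
Qed.

(** * Separation and supports *)

Definition monom (m : posn) : dirichlet := << m >>.

Definition var (n : nat) : posn := insubd posn_one n.

Section DirichletGolomb.
Variables (N : pointedType) (A : nat -> set N).
Hypothesis A2 : A 2 = [set: N].
Implicit Types (f g s t : dirichlet) (m n : posn) (p : N).

Definition bad p : nat_pred := [pred q | `[< ~ A q p >]].

Definition lead p f m := is_lead (posn_lt (bad p)) f m.

(** The monomial lies outside the prime ideal [P_p] generated by the variables that are bad at
    [p]. *)
Definition good p m := ((val m)`_(bad p) = 1)%N.

Definition supp f : set N := [set p | exists m, f@_m != 0 /\ good p m].

Lemma logn_mmul m n : logn 2 (val (mmul m n)) = (logn 2 (val m) + logn 2 (val n))%N.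
Proof. by rewrite /= lognM; [|exact: (valP m)|exact: (valP n)]. Qed.

Lemma logn_one : logn 2 (val posn_one) = 0%N.
Proof. exact: logn1. Qed.

Lemma lead_mul p f g m n : lead p f m -> lead p g n -> lead p (f * g) (mmul m n).
Proof.
by apply: is_lead_mul; [exact: posn_lt_irr|exact: posn_lt_trans|exact: posn_lt_mul].
Qed.

Lemma lead_unique p f m n : lead p f m -> lead p f n -> m = n.
Proof. by apply: is_lead_unique; [exact: posn_lt_irr|exact: posn_lt_trans]. Qed.

Lemma lead_exists p f : f != 0 -> exists m, lead p f m.
Proof. by apply: exists_lead; [exact: posn_lt_trans|exact: posn_lt_total]. Qed.

Lemma good_mul p m n : good p (mmul m n) <-> good p m /\ good p n.
Proof.
rewrite /good /= partnM; [|exact: (valP m)|exact: (valP n)].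
by split=> [/eqP|[-> ->] //]; rewrite muln_eq1 => /andP[/eqP -> /eqP ->].
Qed.

(** The order compares bad parts first, so if some monomial of [f] is good then the leading one
    is. *)
Lemma supp_lead f p m : lead p f m -> supp f p <-> good p m.
Proof.
move=> [fm lm]; split=> [[n [fn gn]]|gm]; last by exists m.
have [<-//|nm] := eqVneq n m; have := lm _ fn nm.
rewrite /posn_lt /good in gn *; rewrite gn => /orP[|/andP[/eqP//]].
by rewrite ltnNge part_gt0.
Qed.

(** This is the primality of the ideals [P_p]: leading monomials multiply, and a product is good iff
    both factors are. *)
Lemma suppM f g : f != 0 -> g != 0 -> supp (f * g) = supp f `&` supp g.
Proof.
move=> f0 g0; apply/seteqP; split=> p; have [m fm] := lead_exists p f0;
  have [n gn] := lead_exists p g0.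
  by move=> /(supp_lead (lead_mul fm gn))/good_mul[? ?]; split;
    [apply/(supp_lead fm)|apply/(supp_lead gn)].
move=> [/(supp_lead fm) gm /(supp_lead gn) g_n].
by apply/(supp_lead (lead_mul fm gn))/good_mul.
Qed.

Definition lead_one s := forall p, lead p s posn_one.

Fact lead_one1 : lead_one 1.
Proof.
move=> p; split=> [|n]; rewrite mcoeff1 ?eqxx ?oner_eq0 //.
by case: (n =P mone) => [-> _ /eqP[]//|_]; rewrite eqxx.
Qed.

Fact lead_oneM s t : lead_one s -> lead_one t -> lead_one (s * t).
Proof.
move=> Ws Wt p; have := lead_mul (Ws p) (Wt p).
by congr (lead _ _ _); apply: val_inj.
Qed.

Fact lead_one_neq0 s : lead_one s -> s != 0.
Proof. by move=> /(_ point); apply: is_lead_neq0. Qed.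

Definition lead_ones := MultSet lead_one1 lead_oneM lead_one_neq0.

Lemma supp_lead_one s : lead_one s -> supp s = [set: N].
Proof.
by move=> Ws; apply/seteqP; split=> // p _; apply/(supp_lead (Ws p)); apply: partn1.
Qed.

Definition golomb_ring : idomainType := localization lead_ones.

Definition loc_supp (x : golomb_ring) : set N :=
  [set p | exists f s (Ws : lead_ones s), x = loc_frac f Ws /\ supp f p].

(** Two representations satisfy [f t = g s], and denominators have full support, so [suppM] makes
    the supports of the numerators agree. *)
Lemma loc_supp_frac f s (Ws : lead_ones s) :
  f != 0 -> loc_supp (loc_frac f Ws) = supp f.
Proof.
move=> f0; apply/seteqP; split=> p; last by move=> fp; exists f, s, Ws.
move=> [g [t [Wt [/eqP + gp]]]]; rewrite loc_frac_eq => /eqP fg.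
have g0 : g != 0.
  apply: contraTneq f0 => g0; move: fg; rewrite g0 mul0r => /eqP.
  by rewrite mulf_eq0 (negPf (mset_neq0 Wt)) orbF => ->.
have := suppM f0 (mset_neq0 Wt); rewrite fg (suppM g0 (mset_neq0 Ws)).
by rewrite (supp_lead_one Ws) (supp_lead_one Wt) !setIT => <-.
Qed.

Lemma var_val q : (0 < q)%N -> val (var q) = q.
Proof. by move=> q0; rewrite /var val_insubd q0. Qed.

Lemma lead_monom p m : lead p (monom m) m.
Proof.
split=> [|n]; rewrite mcoeffU1 ?eqxx ?oner_eq0 //.
by case: (m =P n) => [->|_] /=; rewrite ?eqxx.
Qed.

Lemma good_prime p q : prime q -> good p (var q) <-> A q p.
Proof.
move=> qp; rewrite /good var_val ?prime_gt0 //; split=> [|Aq].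
  move=> q1; apply: contrapT => Aq.
  have qb : (bad p).-nat q by rewrite pnatE // inE.
  by move: (prime_gt1 qp); rewrite -(part_pnat_id qb) q1.
by rewrite part_p'nat // pnatE // inE; apply/negP; rewrite inE => /(_ Aq).
Qed.

Lemma supp_monom m : supp (monom m) = [set p | good p m].
Proof. by apply/seteqP; split=> p; rewrite (supp_lead (lead_monom p m)). Qed.

(** At a point of its support, [f] has a good leading monomial. Its product with [X_2], which is
    never killed, is still good and of positive degree in [X_2], so it comes before 1. *)
Lemma lead_coprime p f : supp f p ->
  exists2 m, lead p (1 - monom (var 2) * f) m & (0 < logn 2 (val m))%N.
Proof.
move=> fp; have f0 : f != 0 by case: fp => m [fm _]; apply: contraNneq fm => ->; rewrite mcoeff0.
have [m fm] := lead_exists p f0.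
have gm : good p (mmul (var 2) m).
  by apply/good_mul; split; [apply/good_prime; rewrite ?A2|apply/(supp_lead fm)].
have l2 : (0 < logn 2 (val (mmul (var 2) m)))%N.
  by rewrite logn_mmul var_val.
exists (mmul (var 2) m) => //.
rewrite addrC; apply: is_leadD; first exact: posn_lt_irr.
  by apply: is_leadN; apply: lead_mul fm; apply: lead_monom.
move=> n; rewrite mcoeff1; case: (n =P mone) => [-> _|_]; last by rewrite eqxx.
by rewrite /posn_lt gm partn1 eqxx logn_one l2 orbT.
Qed.

Lemma logn_lead_mul p f g m n k : lead p f m -> lead p g n -> lead p (f * g) k ->
  logn 2 (val k) = (logn 2 (val m) + logn 2 (val n))%N.
Proof.
move=> fm gn /(lead_unique (lead_mul fm gn)) <-.
by rewrite logn_mmul.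
Qed.

Lemma logn_lead_exp p f m j k : lead p f m -> lead p (f ^+ j) k ->
  logn 2 (val k) = (j * logn 2 (val m))%N.
Proof.
move=> fm; elim: j k => [|j IHj] k fk.
  by rewrite (lead_unique fk (lead_one1 p)) logn_one.
have fj0 : f ^+ j != 0 by rewrite expf_neq0 ?(is_lead_neq0 fm).
have [l fl] := lead_exists p fj0.
by rewrite exprS in fk; rewrite (logn_lead_mul fm fl fk) (IHj _ fl) mulSn.
Qed.

(** Hence any power of [1 - z w] generates an ideal that is still coprime to [z]. *)
Lemma unit_expr (K : comNzRingType) (z w : K) k :
  exists r, 1 - z * r = (1 - z * w) ^+ k.
Proof.
elim: k => [|k [r rE]]; first by exists 0; rewrite mulr0 subr0 expr0.
by exists (w + r - w * z * r); rewrite exprS -rE; ring.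
Qed.

(** The numerator of [1 - x y r] is [s t u - f g h]. Since [f g h] has empty support, all its
    monomials are bad at every point and come after 1, the leading monomial of [s t u]; the
    numerator is thus a denominator too. *)
Lemma golomb_ring_not_separated (x y : golomb golomb_ring) :
  loc_supp (val x) `&` loc_supp (val y) = set0 -> ~ nbhs_separated x y.
Proof.
move=> xy; apply: golomb_not_separated => r.
have [f [s [Ws xE]]] := localizationP (val x).
have [g [t [Wt yE]]] := localizationP (val y).
have [h [u [Wu ->]]] := localizationP r.
have f0 : f != 0 by rewrite -(loc_frac0 f Ws) -xE (valP x).
have g0 : g != 0 by rewrite -(loc_frac0 g Wt) -yE (valP y).
move: xy; rewrite xE yE !loc_supp_frac // => fg.
rewrite loc_frac_1subM; apply: loc_frac_unit => p.
apply: is_leadD; first exact: posn_lt_irr.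
  exact: (msetM (msetM Ws Wt) Wu).
move=> n; rewrite mcoeffN oppr_eq0 => fghn.
rewrite /posn_lt /= partn1.
suff : ((val n)`_(bad p) != 1)%N.
  by have := part_gt0 (bad p) (val n); case: (partn _ _) => [//|[//|k]].
apply/eqP => gn.
have fgh : supp (f * g * h) p by exists n.
have h0 : h != 0 by apply: contraNneq fghn => ->; rewrite mulr0 mcoeff0.
by move: fgh; rewrite !suppM ?mulf_neq0 // fg => -[].
Qed.

Lemma golomb_ring_separated (x y : golomb golomb_ring) p : x <> y ->
  loc_supp (val x) p -> loc_supp (val y) p -> nbhs_separated x y.
Proof.
move=> xy.
have [f [s [Ws xE]]] := localizationP (val x).
have [g [t [Wt yE]]] := localizationP (val y).
have f0 : f != 0 by rewrite -(loc_frac0 f Ws) -xE (valP x).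
have g0 : g != 0 by rewrite -(loc_frac0 g Wt) -yE (valP y).
rewrite xE yE !loc_supp_frac // => fp gp.
have fgp : supp (f * g) p by rewrite suppM.
have [m am m0] := lead_coprime fgp.
set a := 1 - _ in am.
have a0 : a != 0 := is_lead_neq0 am.
have d0 : f * t - g * s != 0.
  apply: contra_notN xy => d0; apply/val_inj/eqP.
  by rewrite xE yE loc_frac_eq -subr_eq0.
have [d dl] := lead_exists p d0.
(* The exponent exceeds by one the degree in [X_2] of the leading monomial at [p] of the numerator
   of [x - y]. *)
pose b := loc_frac (a ^+ (logn 2 (val d)).+1) (mset1 lead_ones).
have b0 : b != 0 by rewrite /b loc_frac0; exact: expf_neq0 a0.
(* Both points divide [X_2 f g], so [unit_expr] makes [b] coprime to each of them. *)
have bcop (z w : golomb_ring) : z * w = loc_frac (monom (var 2) * (f * g)) (mset1 lead_ones) ->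
    ideal_coprime z [set b * r | r in [set: golomb_ring]].
  move=> zw; have [r rE] := unit_expr z w (logn 2 (val d)).+1.
  by exists r, 1 => //; rewrite mulr1 rE zw loc_frac_1subX.
apply: (golomb_separated (is_ideal_principal b)).
- by apply: (neq0_ideal b0); exists 1; rewrite ?mulr1.
- apply: (bcop _ (loc_frac (monom (var 2) * g * s) (mset1 lead_ones))).
  by rewrite xE loc_fracM_clear.
- apply: (bcop _ (loc_frac (monom (var 2) * f * t) (mset1 lead_ones))).
  by rewrite yE loc_fracM_clear (mulrC g).
move=> [r _]; rewrite xE yE.
have [h [u [Wu ->]]] := localizationP r.
move=> /loc_fracB_dvd ah.
have h0 : h != 0.
  apply: contraNneq d0 => h0; move/eqP: ah; rewrite h0 mulr0 mul0r eq_sym.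
  by rewrite mulf_eq0 (negPf (mset_neq0 Wu)) orbF.
have [j hj] := lead_exists p h0.
have [k ak] := lead_exists p (expf_neq0 (logn 2 (val d)).+1 a0).
have dk := lead_mul dl (Wu p).
rewrite -ah in dk.
have := logn_lead_mul (lead_mul ak hj) (msetM Ws Wt p) dk.
(* Denominators have degree 0 in [X_2]. What remains is [D = (D + 1) M + J], with [D], [M], [J] the
   degrees for [x - y], [a] and [h], which [M > 0] forbids. *)
rewrite !logn_mmul !logn_one !addn0 (logn_lead_exp am ak).
have absurd M D J : (0 < M)%N -> D <> (D.+1 * M + J)%N.
  by move=> /(leq_pmulr D.+1); move: (_ * _)%N => X; lia.
exact: absurd m0.
Qed.
End DirichletGolomb.

(** * Supports as a topological invariant *)

Lemma supports_transport (N X X' : Type) (D : X -> set N) (D' : X' -> set N)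
    (phi : X -> X') (psi : X' -> X) (e : N -> X) (e' : N -> X') :
  cancel phi psi -> cancel psi phi ->
  (forall p, D (e p) = [set p]) -> (forall p, D' (e' p) = [set p]) ->
  (forall x y, D' (phi x) `&` D' (phi y) !=set0 <-> D x `&` D y !=set0) ->
  exists2 sigma : N -> N, injective sigma & forall x, D' (phi x) = sigma @` D x.
Proof.
move=> phiK psiK De De' DD'.
have meet' x' y : D' x' `&` D' (phi y) !=set0 <-> D (psi x') `&` D y !=set0.
  by rewrite -DD' psiK.
have ex p : exists q, D' (phi (e p)) q.
  have : D (e p) `&` D (e p) !=set0 by exists p; rewrite De.
  by rewrite -DD' => -[q []]; exists q.
(* Only the meeting relation is transported, but [p] is in [D x] iff [D (e p)] meets [D x]. The
   chosen point [sigma p] is shown below to be the whole support of [phi (e p)]. *)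
pose sigma p := sval (cid (ex p)).
have sigmaP p : D' (phi (e p)) (sigma p) := svalP (cid (ex p)).
have back p q : D' (phi (e p)) q -> D (psi (e' q)) p.
  move=> pq; have /meet'[r []] : D' (e' q) `&` D' (phi (e p)) !=set0.
    by exists q; rewrite De'.
  by rewrite De => qr <-.
(* By [back], both preimages have [p] in their support, hence meet; so the singletons at [q] and
   [sigma p] meet. *)
have single p q : D' (phi (e p)) q -> q = sigma p.
  move=> pq; have : D (psi (e' q)) `&` D (psi (e' (sigma p))) !=set0.
    by exists p; split; apply: back.
  by rewrite -DD' !psiK !De' => -[r [-> ->]].
(* Dually, the point with support [sigma p] comes from one whose support is no larger than [p]. *)
have preim p r : D (psi (e' (sigma p))) r -> r = p.
  move=> pr; have : D (psi (e' (sigma p))) `&` D (e r) !=set0 by exists r; rewrite De.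
  rewrite -DD' psiK De' => -[_ [-> /= rp]].
  have : D' (phi (e r)) `&` D' (phi (e p)) !=set0 by exists (sigma p).
  by rewrite DD' !De => -[_ [-> ->]].
have mem x p : D' (phi x) (sigma p) <-> D x p.
  split=> [xp|xp].
    have : D' (e' (sigma p)) `&` D' (phi x) !=set0 by exists (sigma p); rewrite De'.
    by rewrite meet' => -[r [/preim -> ]].
  have : D (psi (e' (sigma p))) `&` D x !=set0 by exists p; split=> //; apply: back.
  by rewrite -meet' De' => -[_ [-> ]].
exists sigma.
  by move=> p q pq; apply/esym/preim; rewrite pq; apply: back.
move=> x; apply/seteqP; split=> [q xq|_ [p xp <-]]; last exact/mem.
have /meet'[p [qp xp]] : D' (e' q) `&` D' (phi x) !=set0 by exists q; rewrite De'.
exists p => //; apply/esym/single.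
have : D (psi (e' q)) `&` D (e p) !=set0 by exists p; rewrite De.
by rewrite -meet' De' => -[_ [-> ]].
Qed.

(* [nbhs_separated x x] never holds, whence the special case [x = y]. *)
Definition meets (X : topologicalType) (x y : X) :=
  nbhs_separated x y \/ x = y /\ exists z, nbhs_separated x z.

Lemma meets_homeo (X Y : topologicalType) (f : X -> Y) (g : Y -> X) :
  cancel f g -> cancel g f -> continuous f -> continuous g ->
  forall x y, meets (f x) (f y) <-> meets x y.
Proof.
move=> fK gK fc gc x y; have sep := nbhs_separated_homeo fK gK fc gc.
split=> -[/sep|[xy [z xz]]]; [by left|right|by left|right; split; first by rewrite xy].
  by split; [exact: (can_inj fK)|exists (g z); apply/sep; rewrite gK].
by exists (f z); apply/sep.
Qed.

Definition minimal_infinite (T : Type) (F : set (set T)) (D : set T) :=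
  [/\ F D, infinite_set D & forall E, F E -> infinite_set E -> E `<=` D -> E = D].

Lemma minimal_infinite_image (T U : Type) (f : T -> U) (F : set (set T)) (G : set (set U)) D :
  injective f -> G = (fun E => f @` E) @` F ->
  minimal_infinite F D -> minimal_infinite G (f @` D).
Proof.
move=> fi -> [FD Di Dm].
have inf E : infinite_set (f @` E) <-> infinite_set E.
  have fiE : {in E &, injective f} by move=> x y _ _ /fi.
  by rewrite (eq_finite_set (inj_card_eq fiE)).
split; [by exists D|exact/inf|].
move=> _ [E FE <-] /inf Ei ED; congr (_ @` _); apply: Dm => // x Ex.
have [y Dy /fi <- //] : (f @` D) (f x) by apply: ED; exists x.
Qed.

(** * Countability, a nonunit, and the supports of points *)

Section RingFacts.
Variables (N : pointedType) (A : nat -> set N).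
Hypothesis A2 : A 2 = [set: N].
Local Notation R := (golomb_ring A).

Definition loc_monom (m : posn) : R := loc_frac (monom m) (mset1 (lead_ones A)).

Lemma monom_neq0 m : monom m != 0.
Proof. exact: is_lead_neq0 (lead_monom A point m). Qed.

Lemma loc_monom_neq0 m : loc_monom m != 0.
Proof. by rewrite loc_frac0; apply: monom_neq0. Qed.

Lemma loc_monom_inj : injective loc_monom.
Proof.
move=> m n /eqP; rewrite loc_frac_eq !mulr1 => /eqP mn.
by apply: (@lead_unique _ A point (monom m)); [|rewrite mn]; apply: lead_monom.
Qed.

Lemma golomb_ring_countably_infinite : countably_infinite R.
Proof.
apply: eq_card_nat; first exact: (localization_countable _ dirichlet_countable).
apply/infiniteP/(@injective_card_le _ _ _ _ (fun n => loc_monom (var n.+1))) => //.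
by move=> m n _ _ /loc_monom_inj /(congr1 val); rewrite !var_val // => -[].
Qed.

(** The variable [X_2] has no inverse: [X_2 h = u] would make the leading monomial of the
    denominator [u] even, while it is 1. *)
Lemma golomb_ring_not_field : ~ GRing.field_axiom R.
Proof.
move=> /(_ _ (loc_monom_neq0 (var 2))) /unitrPr[y].
have [h [u [Wu ->]]] := localizationP y.
rewrite loc_fracM -(loc_frac1 (lead_ones A)) => /eqP.
rewrite loc_frac_eq mulr1 !mul1r => /eqP hu.
have h0 : h != 0.
  by apply: contraNneq (mset_neq0 Wu) => h0; rewrite -hu h0 mulr0.
have [m hm] := lead_exists A point h0.
have := Wu point; rewrite -hu => /(lead_unique (lead_mul (lead_monom A point _) hm)).
move=> /(congr1 (fun m : posn => logn 2 (val m))) /=.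
by rewrite var_val // lognM ?(valP m) // logn1.
Qed.

Definition golomb_monom (m : posn) : golomb R := exist _ (loc_monom m) (loc_monom_neq0 m).

Definition gsupp (x : golomb R) : set N := loc_supp (val x).

Lemma gsupp_monom m : gsupp (golomb_monom m) = [set p | good A p m].
Proof. by rewrite /gsupp /= loc_supp_frac ?supp_monom //; apply: monom_neq0. Qed.

Lemma gsupp_bigcup x : exists s : seq posn,
  gsupp x = \bigcup_(m in [set` s]) [set p | good A p m].
Proof.
have [f [s [Ws xE]]] := localizationP (val x).
have f0 : f != 0 by rewrite -(loc_frac0 f Ws) -xE (valP x).
exists (msupp f : seq posn).
rewrite /gsupp xE loc_supp_frac //; apply/seteqP; split=> p [m].
  by rewrite mcoeff_neq0 => -[fm gm]; exists m.
by move=> fm gm; exists m; rewrite mcoeff_neq0.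
Qed.

Lemma meets_gsupp (x y : golomb R) : meets x y <-> gsupp x `&` gsupp y !=set0.
Proof.
have sepP (u v : golomb R) : nbhs_separated u v -> gsupp u `&` gsupp v !=set0.
  by move=> uv; apply/set0P/eqP => uv0; apply: (golomb_ring_not_separated uv0 uv).
split=> [[/sepP//|[<- [z /sepP[p [xp _]]]]]|[p [xp yp]]]; first by exists p.
have [xy|] := pselect (x = y); last by left; apply: (golomb_ring_separated A2 _ xp yp).
right; split=> //.
(* When [x = y], a point different from [x] is needed that meets it: 1 and [X_2] both have full
   support, and one of them is not [x]. *)
have allp m : m = posn_one \/ m = var 2 -> gsupp (golomb_monom m) p.
  rewrite gsupp_monom => -[->|->]; first exact: partn1.
  by apply/good_prime; rewrite ?A2.
have [x1|x1] := pselect (x = golomb_monom posn_one).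
  exists (golomb_monom (var 2)); apply: (golomb_ring_separated A2 _ xp (allp _ _)); last by right.
  rewrite x1 => /(congr1 val)/loc_monom_inj/(congr1 val).
  by rewrite var_val.
exists (golomb_monom posn_one); apply: (golomb_ring_separated A2 x1 xp (allp _ _)).
by left.
Qed.
End RingFacts.

(** * Almost disjoint families *)

Section PrimeCoding.

Definition next_prime (n : nat) : nat := s2val (prime_above n).

(** The [n.+1] steps skip 2 itself, reserved for the variable that is never killed. *)
Definition odd_prime (n : nat) : nat := iter n.+1 next_prime 2.

Lemma next_prime_gt n : (n < next_prime n)%N.
Proof. exact: (s2valP (prime_above n)). Qed.

Lemma odd_prime_prime n : prime (odd_prime n).
Proof. exact: (s2valP' (prime_above _)). Qed.

Lemma odd_prime_lt m n : (m < n)%N -> (odd_prime m < odd_prime n)%N.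
Proof.
elim: n => // n IHn; rewrite ltnS leq_eqVlt => /predU1P[->|/IHn mn]; first exact: next_prime_gt.
exact: ltn_trans mn (next_prime_gt _).
Qed.

Lemma odd_prime_inj : injective odd_prime.
Proof.
move=> m n mn; have [/odd_prime_lt|/odd_prime_lt|//] := ltngtP m n; by rewrite mn ltnn.
Qed.

Lemma odd_prime_gt2 n : (2 < odd_prime n)%N.
Proof.
elim: n => [|n IHn]; first exact: next_prime_gt.
exact: ltn_trans IHn (next_prime_gt _).
Qed.

End PrimeCoding.

Section AlmostDisjoint.
Local Notation N := (nat * nat)%type.
Variable C : nat -> set N.

Definition coded (v : N + nat) : set N :=
  match v with inl p => [set p] | inr i => C i end.

Definition code_prime (v : N + nat) : nat := odd_prime (choice.pickle v).

(** A prime other than 2 that codes nothing gets the empty set: its variable is killed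
    everywhere. *)
Definition prime_sets (q : nat) : set N :=
  [set p | q = 2 \/ exists2 v, q = code_prime v & coded v p].

Lemma prime_sets2 : prime_sets 2 = [set: N].
Proof. by apply/seteqP; split=> // p _; left. Qed.

Lemma prime_sets_code v : prime_sets (code_prime v) = coded v.
Proof.
apply/seteqP; split=> p; last by move=> vp; right; exists v.
move=> [v2|[w /odd_prime_inj/(pcan_inj (@choice.pickleK _)) <-]//].
by have := odd_prime_gt2 (choice.pickle v); rewrite -/(code_prime v) v2.
Qed.


Hypothesis C0inf : infinite_set (C 0).
Hypothesis Cinf : forall i, infinite_set (C i) \/ C i = set0.
Hypothesis Cdisj : forall i j, i != j -> finite_set (C i `&` C j).

Local Notation A := prime_sets.
Local Notation R := (golomb_ring A).

Lemma goodP p m : good A p m <-> forall q, prime q -> (q %| val m)%N -> A q p.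
Proof.
have m0 : (0 < val m)%N by exact: (valP m).
rewrite /good; split=> [/eqP|h].
  rewrite partn_eq1 // => /pnatP-/(_ m0) h q qp /(h q qp); rewrite inE => /negP.
  by rewrite inE => /contrapT.
apply/eqP; rewrite partn_eq1 //; apply/pnatP => // q qp /(h q qp) Aq.
by rewrite inE; apply/negP; rewrite inE => /(_ Aq).
Qed.

(** The support of a monomial is the intersection of the [A q] over its prime factors. An infinite
    one involves no singleton and no two different [C i], so it is either everything or a single
    [C i]. *)
Lemma infinite_monom m : infinite_set [set p | good A p m] ->
  exists i, infinite_set (C i) /\ C i `<=` [set p | good A p m].
Proof.
move=> mi; have sub q : prime q -> (q %| val m)%N -> [set p | good A p m] `<=` A q.
  by move=> qp qm p /goodP; apply.
have prime_of q : prime q -> (q %| val m)%N -> q = 2 \/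
    exists2 i, q = code_prime (inr i) & infinite_set (C i).
  move=> qp qm; apply: contrapT => /not_orP[q2 qC]; apply: mi.
  apply: sub_finite_set (sub q qp qm) _.
  have [[v qv]|nov] := pselect (exists v, q = code_prime v); last first.
    apply: sub_finite_set (finite_set0 _) => p [//|[v qv _]].
    by apply: nov; exists v.
  rewrite qv prime_sets_code; case: v qv => [p _|i qi] /=; first exact: finite_set1.
  by have [Ci|->] := Cinf i; [case: qC; exists i|exact: finite_set0].
have [[q [qp qm q2]]|allq2] :=
    pselect (exists q, [/\ prime q, (q %| val m)%N & q <> 2]); last first.
  (* Only 2 can divide [m], so the support is everything and [C 0] fits. *)
  exists 0; split=> // p _; apply/goodP => q qp qm; rewrite (_ : q = 2) ?prime_sets2 //.
  by apply: contrapT => q2; apply: allq2; exists q.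
have [//|[i qi Ci]] := prime_of q qp qm; exists i; split=> // p Cp.
apply/goodP => r rp rm; have [->|[j rj Cj]] := prime_of r rp rm; first by rewrite prime_sets2.
rewrite rj prime_sets_code /=; have [<-//|/Cdisj ij] := eqVneq i j; case: mi.
apply: sub_finite_set ij => s ms; split.
  by have := sub _ qp qm _ ms; rewrite qi prime_sets_code.
by have := sub _ rp rm _ ms; rewrite rj prime_sets_code.
Qed.

Lemma infinite_gsupp (x : golomb R) : infinite_set (gsupp x) ->
  exists i, infinite_set (C i) /\ C i `<=` gsupp x.
Proof.
have [s ->] := gsupp_bigcup x => xi.
have [[m ms mi]|fin] := pselect (exists2 m, m \in s & infinite_set [set p | good A p m]).
  have [i [Ci Cm]] := infinite_monom mi; exists i; split=> // p /Cm gm.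
  by exists m.
case: xi; apply: bigcup_finite; first exact: finite_seq.
by move=> m ms; apply: contrapT => mi; apply: fin; exists m.
Qed.

Lemma gsupp_coded v : gsupp (golomb_monom A (var (code_prime v))) = coded v.
Proof.
rewrite gsupp_monom -prime_sets_code; apply/seteqP; split=> p /=;
  by rewrite good_prime //; apply: odd_prime_prime.
Qed.

(** Every infinite support contains an infinite [C i], and almost disjointness prevents an infinite
    [C i] from lying inside another [C j]. *)
Lemma minimal_infinite_gsupp D :
  minimal_infinite (range (@gsupp _ A)) D <-> exists i, infinite_set (C i) /\ D = C i.
Proof.
have CR i : range (@gsupp _ A) (C i).
  by exists (golomb_monom A (var (code_prime (inr i)))); rewrite ?gsupp_coded.
have subC i j : infinite_set (C i) -> C i `<=` C j -> i = j.
  move=> Ci Cij; apply/eqP; apply: contrapT => /negP/Cdisj; rewrite setIidl //.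
split=> [[[x _ <-] xi xm]|[i [Ci ->]]].
  have [i [Ci Cx]] := infinite_gsupp xi; exists i; split=> //.
  by apply/esym/xm.
split=> // _ [x _ <-] /infinite_gsupp[j [Cj Cx]] xC; apply/seteqP; split=> //.
by rewrite -(subC j i) //; apply: subset_trans xC.
Qed.

End AlmostDisjoint.

(** * The triangle, the columns, and the recovery of [S] *)

Definition columns (S : set nat) (i : nat) : set (nat * nat) :=
  if i is k.+1 then [set p | p.1 = k.+1 /\ S k] else [set p | (p.2 < p.1)%N].

Section Columns.
Variable S : set nat.

Lemma column_triangle k : S k ->
  columns S 0 `&` columns S k.+1 = (fun m => (k.+1, m)) @` `I_k.+1.
Proof.
move=> Sk; apply/seteqP; split=> [[n m] /= [mn [nk _]]|_ [m mk <-]] /=.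
  by subst n; exists m.
by split.
Qed.

(** The size determines [k], and it is positive thanks to the shift in [k.+1], whereas two different
    columns are disjoint. *)
Lemma card_column_triangle k : S k -> columns S 0 `&` columns S k.+1 #= `I_k.+1.
Proof.
move=> /column_triangle ->; have inj : {in `I_k.+1 &, injective (fun m => (k.+1, m))}.
  by move=> m n _ _ [].
exact: inj_card_eq inj.
Qed.

Lemma columns_disjoint k l : k != l -> columns S k.+1 `&` columns S l.+1 = set0.
Proof.
move=> /eqP kl; apply/seteqP; split=> // p [[pk _] [pl _]]; apply: kl.
by case: pl; rewrite pk => -[].
Qed.

Lemma columns_finiteI i j : i != j -> finite_set (columns S i `&` columns S j).
Proof.
have fin0 k : finite_set (columns S 0 `&` columns S k.+1).
  have [Sk|Sk] := pselect (S k).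
    by apply/finite_setP; exists k.+1; apply: card_column_triangle.
  by apply: sub_finite_set (finite_set0 _) => p [_ []].
case: i j => [|i] [|j] // ij; first by rewrite setIC; apply: fin0.
by rewrite columns_disjoint.
Qed.

Lemma infinite_injection (T : Type) (F : nat -> T) (D : set T) :
  injective F -> (forall n, D (F n)) -> infinite_set D.
Proof.
move=> Fi FD; apply/infiniteP/(@injective_card_le _ _ _ _ F) => //.
by move=> m n _ _ /Fi.
Qed.

Lemma columns_infinite0 : infinite_set (columns S 0).
Proof. by apply: (@infinite_injection _ (fun n => (n.+1, 0%N))) => // m n []. Qed.

Lemma columns_infinite k : S k -> infinite_set (columns S k.+1).
Proof. by move=> Sk; apply: (@infinite_injection _ (fun n => (k.+1, n))) => // m n []. Qed.

Lemma columns_infiniteVempty i : infinite_set (columns S i) \/ columns S i = set0.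
Proof.
case: i => [|k]; first by left; apply: columns_infinite0.
have [Sk|Sk] := pselect (S k); first by left; apply: columns_infinite.
by right; apply/seteqP; split=> // p [].
Qed.

Definition ring_of : idomainType := golomb_ring (prime_sets (columns S)).

Lemma minimal_infinite_ring_of D :
  minimal_infinite (range (@gsupp _ (prime_sets (columns S)))) D <->
  exists i, infinite_set (columns S i) /\ D = columns S i.
Proof.
exact: minimal_infinite_gsupp columns_infinite0 columns_infiniteVempty columns_finiteI D.
Qed.

End Columns.

Lemma ring_of_homeo_subset S S' :
  homeomorphic (golomb (ring_of S)) (golomb (ring_of S')) -> S `<=` S'.
Proof.
move=> [f [g [fK gK fc gc]]] k Sk.
pose e T p : golomb (ring_of T) :=
  golomb_monom (prime_sets (columns T)) (var (code_prime (inl p))).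
have eP T p : gsupp (e T p) = [set p] by rewrite gsupp_coded.
have DD' x y : gsupp (f x) `&` gsupp (f y) !=set0 <-> gsupp x `&` gsupp y !=set0.
  rewrite -!meets_gsupp; [|exact: prime_sets2|exact: prime_sets2].
  exact: meets_homeo.
have [sigma si sP] := supports_transport fK gK (eP S) (eP S') DD'.
have rangeE : range (@gsupp _ (prime_sets (columns S'))) =
    (fun E => sigma @` E) @` range (@gsupp _ (prime_sets (columns S))).
  apply/seteqP; split=> [_ [x _ <-]|_ [_ [x _ <-] <-]]; last by exists (f x).
  by exists (gsupp (g x)); [exists (g x)|rewrite -sP gK].
have img i : infinite_set (columns S i) ->
    exists j, infinite_set (columns S' j) /\ sigma @` columns S i = columns S' j.
  move=> Ci; apply/minimal_infinite_ring_of.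
  by apply: minimal_infinite_image si rangeE _; apply/minimal_infinite_ring_of; exists i.
have [a [Ca aE]] := img _ (@columns_infinite0 S).
have [b [Cb bE]] := img _ (columns_infinite Sk).
(* The injection [sigma] preserves the size of the intersection of the triangle with column
   [k.+1]. *)
have : columns S' a `&` columns S' b #= `I_k.+1.
  have -> : columns S' a `&` columns S' b = sigma @` (columns S 0 `&` columns S k.+1).
    rewrite -aE -bE; apply/seteqP; split; last exact: sub_image_setI.
    by move=> _ [[p Cp <-] [q Cq /si qp]]; exists p; rewrite // -qp in Cp *; split.
  apply: card_eq_trans _ (card_column_triangle Sk).
  by apply: inj_card_eq => x y _ _ /si.
have sing l : infinite_set (columns S' l.+1) -> S' l.
  move=> Cl; apply: contrapT => S'l; apply: Cl.
  by apply: sub_finite_set (finite_set0 _) => p [].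
have tri l : infinite_set (columns S' l.+1) ->
    columns S' 0 `&` columns S' l.+1 #= `I_k.+1 -> S' k.
  move=> /sing S'l lk.
  by have /card_eq_II[<-] := card_eq_trans (card_esym (card_column_triangle S'l)) lk.
have diag l : infinite_set (columns S' l) -> ~ (columns S' l `&` columns S' l #= `I_k.+1).
  by rewrite setIid => Cl lk; apply: Cl; apply/finite_setP; exists k.+1.
(* The size [k.+1] is finite, so [a] and [b] differ, and nonzero, so they are not both columns. One
   is the triangle and the other must then be column [k.+1] of [S']. *)
case: a b Ca Cb {aE bE} => [|a] [|b] Ca Cb.
- by move=> /(diag _ Ca).
- exact: tri.
- by rewrite setIC; apply: tri.
have [ab|ab] := eqVneq a b; first by rewrite -ab => /(diag _ Ca).
rewrite columns_disjoint // => k0.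
have := card_esym k0; rewrite card_eq0 => /eqP/seteqP[].
by move=> /(_ 0%N) /= /(_ isT).
Qed.

Theorem corollary7p6 (R : realType) :
  exists f : R -> golomb_homeo_class, bijective f.
Proof.
apply: (@bijection_golomb_homeo_class R ring_of).
- by move=> S; apply: golomb_ring_countably_infinite.
- by move=> S; apply: golomb_ring_not_field; apply: prime_sets2.
- move=> S S' SS'; apply/seteqP; split; apply: ring_of_homeo_subset => //.
  exact: homeomorphic_sym.
Qed.
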